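(* Let $G$ be a finite group and $p$ a fixed prime divisor of $|G|$. Then every non-nilpotent subgroup of $G$ is a TI-subgroup of $G$ or subnormal in $G$ or has $p'$-order if and only if one of the following statements holds: (1) every non-nilpotent subgroup of $G$ of order divisible by $p$ is subnormal in $G$; (2) $p>2$ and $G=(Z_q)^r\rtimes(Z_p\rtimes H)$ is a Frobenius group with kernel $(Z_q)^r$ and complement $Z_p\rtimes H$, where $q$ is a prime with $q\neq p$ and $r>1$, $Z_p$ is a Sylow $p$-subgroup of $G$, $H$ is either a cyclic group or a direct product of the quaternion group $Q_8$ and a cyclic group of odd order such that $[Z_p,H]\neq 1$, and $Z_p$ acts irreducibly (by conjugation) on $(Z_q)^r$.
   Context: All groups are finite. A subgroup $H$ of a group $G$ is a TI-subgroup of $G$ if for every $g\in G$, $H^g\cap H=1$ or $H^g\cap H=H$. A subgroup has $p'$-order if its order is not divisible by $p$. $Z_n$ denotes the cyclic group of order $n$, $(Z_q)^r$ the elementary abelian group of order $q^r$, and $Q_8$ the quaternion group of order $8$. *)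

(* Defs.v *)
From mathcomp Require Import all_boot all_fingroup all_solvable.
Set Implicit Arguments. Unset Strict Implicit. Unset Printing Implicit Defensive.
Local Open Scope group_scope.

Definition TI_subgroup (gT : finGroupType) (H G : {set gT}) : Prop :=
  forall g, g \in G -> (H :^ g :&: H = 1) \/ (H :^ g :&: H = H).

(* Main.v *)
(** For the direct implication, let [M] be of largest order among the
non-nilpotent, non-subnormal subgroups of [G] of order divisible by [p]. It is
TI, and self-normalising by maximality, so Frobenius' theorem makes it the
complement of a Frobenius kernel [K]. A subnormal subgroup containing an element
[x] with ['C_K[x] = 1] contains [K]; hence a subgroup [L A], with [1 < L < K]
and [A] a complement of [K] normalising [L], would contradict the choice of [M].
So every complement acts irreducibly on [K], and as one of them normalises a
Sylow subgroup of [K], [K] is an elementary abelian [q]-group. Applied to the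
groups [L A] with [A] a subgroup of [M] of order divisible by [p], the
hypothesis shows that such an [A] acts irreducibly on [K]; if [A] is abelian, so
is ['C_M(A)] by Schur's lemma. Abelian subgroups of [M] are cyclic since they
act semiregularly on [K]. The subgroups [K A] are subnormal, so [M] has a normal
Sylow [p]-subgroup [P], which is cyclic. Let [H] be a complement of [P] in [M].
If [1 < A <= P] is normal in [M] and [B <= H] does not centralise [A], then
[A B] is normal in [M]: for [B = H] and [#|A| = p] this gives [#|P| = p], since
some element of [H] acts on [P] without fixed points, and for [A = P] it makes
every subgroup [B] of [H] normal. A Dedekind group whose abelian subgroups are
cyclic is cyclic or the product of ['Q_8] with a cyclic group of odd order.

Conversely, a subgroup [X] of order divisible by [p] contains, up to conjugacy,
[P]; by irreducibility it meets [K] in [1], and then lies in ['N_G(P) = M] and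
is TI, or it contains [K], and is then normal. *)

Require Import Defs.
From mathcomp Require Import all_boot all_fingroup all_solvable all_algebra.
From mathcomp Require Import mxrepresentation mxabelem vcharacter.
Set Implicit Arguments.
Unset Strict Implicit.
Unset Printing Implicit Defensive.
Local Open Scope group_scope.

Section GroupFacts.

Variable gT : finGroupType.
Implicit Types (A C G H K L M P S X : {group gT}) (pi : nat_pred).

Lemma acts_irreducibly_J A K : acts_irreducibly A K 'J = minnormal K A.
Proof. by apply: minset_eq => L; rewrite astabsJ. Qed.

Lemma sdprod_sub_normal G K M X :
  K ><| M = G -> K \subset X -> X \subset G -> M :&: X <| M -> X <| G.
Proof.
move=> /sdprodP[_ defG nKM _] sKX sXG /normal_norm nMX.
have defX: K * (M :&: X) = X by rewrite group_modl // defG (setIidPr sXG).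
rewrite /normal sXG -defG mul_subG ?(subset_trans sKX) ?normG //.
by rewrite -defX normsM.
Qed.

Lemma sdprod_compl_join G K M A :
  K ><| M = G -> A \subset M -> M :&: (K <*> A) = A.
Proof.
case/sdprodP=> _ _ nKM tiKM sAM; rewrite norm_joinEr ?(subset_trans sAM) //.
by rewrite -group_modr // setIC tiKM mul1g.
Qed.

Lemma sdprod_ker_join G K M L A :
    K ><| M = G -> L \subset K -> A \subset M -> A \subset 'N(L) ->
  K :&: (L <*> A) = L.
Proof.
case/sdprodP=> _ _ _ tiKM sLK sAM nLA; have tiKA: K :&: A = 1.
  by apply/trivgP; rewrite -tiKM setIS.
by rewrite norm_joinEr // setIC -group_modl // setIC tiKA mulg1.
Qed.

Lemma dprod_normal_subl G H K A : H \x K = G -> A <| H -> A <| G.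
Proof.
case/dprodP=> _ <- cHK _ /andP[sAH nAH].
rewrite /normal (subset_trans sAH) ?mulG_subl // mul_subG //.
by rewrite cents_norm // (subset_trans cHK) ?centS.
Qed.

Lemma normal_Hall_sdprod_norm_Sylow q G K S :
    K <| G -> Hall G K -> q.-Sylow(K) S ->
  exists2 A : {group gT}, K ><| A = G & A \subset 'N(S).
Proof.
move=> nsKG /andP[sKG coKG] sylS; set N := 'N_G(S).
have defG: K * N = G := Frattini_arg nsKG sylS.
have nsKN_N: K :&: N <| N by rewrite setIC (normalGI _ nsKG) ?subsetIl.
have indexKN: #|N : K :&: N| = #|G : K| by rewrite setIC indexgI -indexMg defG.
have hallKN: Hall N (K :&: N).
  by rewrite /Hall subsetIr indexKN (coprimeSg (subsetIl _ _)).
have /splitsP[A /complP[tiKNA defN]] := SchurZassenhaus_split hallKN nsKN_N.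
have [_ sAN] := mulG_sub defN.
have [sAG nSA] := subsetIP sAN.
exists A => //; rewrite sdprodE ?(subset_trans sAG) ?normal_norm //.
  by rewrite -{1}(mulGSid (subsetIl K N)) -mulgA defN.
by rewrite -(setIidPr sAN) setIA.
Qed.

Lemma subnormal_Hall_normal pi G H : pi.-Hall(G) H -> H <|<| G -> H <| G.
Proof.
have [n] := ubnP #|G|; elim: n => // n IHn in G * => /ltnSE-leGn hallH.
case/subnormalEr=> [<- | [Y [snHY nsYG ltYG]]]; first exact: normal_refl.
have hallHY := pHall_subl (subnormal_sub snHY) (normal_sub nsYG) hallH.
have nsHY := IHn Y (leq_trans (proper_card ltYG) leGn) hallHY snHY.
by rewrite -(normal_Hall_pcore hallHY nsHY) gFnormal_trans.
Qed.

Lemma fixfree_norm_sub K X x :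
  x \in X -> x \in 'N(K) -> 'C_K[x] = 1 -> K \subset 'N(X) -> K \subset X.
Proof.
move=> Xx nKx regKx nXK.
have defxK: x ^: K = x *: K.
  apply/eqP; rewrite eqEcard card_lcoset -index_cent1 regKx indexg1 leqnn andbT.
  apply/subsetP=> _ /imsetP[k Kk ->]; rewrite mem_lcoset -commgEl commgEr.
  by rewrite groupMr // memJ_norm ?groupV.
have: x *: K \subset X by rewrite -defxK class_sub_norm.
by rewrite -sub_lcosetV lcoset_id ?groupV.
Qed.

Lemma fixfree_subnormal_sub G K X x :
    x \in X -> x \in 'N(K) -> 'C_K[x] = 1 -> K \subset G -> X <|<| G ->
  K \subset X.
Proof.
move=> Xx nKx regKx sKG /subnormalP[s]; elim: s X Xx => [|Y s IHs] X Xx /=.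
  by move=> _ ->.
case/andP=> /andP[sXY nXY] snY defG.
apply: (fixfree_norm_sub Xx nKx regKx); apply: subset_trans nXY.
exact: IHs (subsetP sXY _ Xx) snY defG.
Qed.

Lemma cyclic_norm_abelian C A :
  cyclic C -> A \subset 'N(C) -> 'C_A(C) = 1 -> abelian A.
Proof.
move=> cycC nCA regCA.
have injf: 'injm (restrm nCA (conj_aut C)).
  by rewrite ker_restrm ker_conj_aut regCA.
rewrite -(injm_abelian injf (subxx A)).
apply: abelianS (Aut_cyclic_abelian cycC).
by rewrite morphim_restrm Aut_conj_aut.
Qed.

Lemma card2_norm_cent P A : #|P| = 2 -> A \subset 'N(P) -> A \subset 'C(P).
Proof.
move=> oP nPA; rewrite -ker_conj_aut ker_trivg_morphim nPA.
have cycP: cyclic P by rewrite prime_cyclic ?oP.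
have /card1_trivg <-: #|Aut P| = 1%N by rewrite card_Aut_cyclic ?oP.
exact: Aut_conj_aut.
Qed.

Lemma cyclic_pgroup_cent1_eq1 (p : nat) P P0 x :
    p.-group P -> cyclic P -> P0 \subset P -> #|P0| = p -> x \notin 'C(P0) ->
  'C_P[x] = 1.
Proof.
move=> pP cycP sP0P oP0; apply: contraNeq => ntCx.
have [_ p_dvd_Cx _] := pgroup_pdiv (pgroupS (subsetIl P 'C[x]) pP) ntCx.
rewrite -sub_cent1; apply: subset_trans (subsetIr P _).
by rewrite -(cardSg_cyclic cycP) ?subsetIl ?oP0.
Qed.

Lemma dvdn_card_nontrivial (p : nat) A : prime p -> p %| #|A| -> A :!=: 1.
Proof.
move=> p_pr; apply: contraTneq => ->.
by rewrite cards1 dvdn1 neq_ltn (prime_gt1 p_pr) orbT.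
Qed.

Lemma dvdn_card_Sylow (p : nat) G P :
  prime p -> p.-Sylow(G) P -> p %| #|G| -> p %| #|P|.
Proof.
move=> p_pr sylP p_dvd_G; rewrite (card_Hall sylP).
by rewrite -{1}(part_pnat_id (pnat_id p_pr)) partn_dvd.
Qed.

Lemma prime_Sylow_sub_conj (p : nat) G P X :
    prime p -> p.-Sylow(G) P -> #|P| = p -> X \subset G -> p %| #|X| ->
  exists2 g, g \in G & P \subset X :^ g.
Proof.
move=> p_pr sylP oP sXG /Cauchy[//|x Xx ox].
have [||g Gg sxP] := Sylow_subJ sylP (_ : <[x]> \subset G).
- by rewrite cycle_subG (subsetP sXG).
- by rewrite /pgroup -orderE ox pnat_id.
exists g^-1; first by rewrite groupV.
have defPg: <[x]> = P :^ g.
  by apply/eqP; rewrite eqEcard sxP cardJg oP -orderE ox leqnn.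
by rewrite -sub_conjg -defPg cycle_subG.
Qed.

Lemma coprime_join_nonnil A C :
  coprime #|A| #|C| -> ~~ (C \subset 'C(A)) -> ~~ nilpotent (A <*> C).
Proof.
move=> coAC; apply: contra => nilAC.
exact: sub_nilpotent_cent2 nilAC (joing_subl A C) (joing_subr A C) coAC.
Qed.

End GroupFacts.

Section CentralIrreducible.

Import GRing.Theory.
Local Open Scope ring_scope.

Variables (F : fieldType) (gT : finGroupType) (n : nat).
Implicit Types G H : {group gT}.

Lemma abelian_envelop_mx_sub_cent G (rG : mx_representation F G n) :
  abelian G -> (enveloping_algebra_mx rG <= 'C(enveloping_algebra_mx rG))%MS.
Proof.
move=> cGG; apply/row_subP=> i; rewrite rowK memmx_cent_envelop.
apply/centgmxP=> x Gx; have Gi := enum_valP i.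
by rewrite -!repr_mxM // (centsP cGG).
Qed.

(* By cyclicity, f agrees on a nonzero vector with some A in the enveloping
   algebra, and f - A commutes with G: by Schur's lemma, f = A. *)
Lemma abelian_irr_centgmx_envelop G (rG : mx_representation F G n) f :
    abelian G -> mx_irreducible rG -> centgmx rG f ->
  (f \in enveloping_algebra_mx rG)%MS.
Proof.
move=> cGG irrG cGf; have [_ nz1 simG] := irrG.
have /rowV0Pn[u _ nz_u] := nz1.
have /cyclic_mxP[A E_A ufA]: (u *m f <= cyclic_mx rG u)%MS.
  apply: submx_trans (submx1 _) _.
  by rewrite simG ?cyclic_mx_module ?submx1 ?cyclic_mx_eq0.
have cGfA: centgmx rG (f - A).
  rewrite -memmx_cent_envelop linearB addmx_sub ?eqmx_opp //=.
    by rewrite memmx_cent_envelop.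
  exact: submx_trans E_A (abelian_envelop_mx_sub_cent rG cGG).
suff: f - A == 0 by rewrite subr_eq0 => /eqP->.
apply: contraNT nz_u => /(mx_Schur irrG cGfA) unit_fA.
by rewrite -(mulmxK unit_fA u) mulmxBr ufA subrr mul0mx.
Qed.

Lemma mx_faithful_central_irr_abelian G H (sHG : H \subset G)
    (rG : mx_representation F G n) :
    mx_faithful rG -> mx_irreducible (subg_repr rG sHG) -> H \subset 'Z(G)%g ->
  abelian G.
Proof.
move=> ffulG irrH; rewrite subsetI => /andP[_ cGH].
set rH := subg_repr rG sHG in irrH.
have centH x : x \in G -> centgmx rH (rG x).
  move=> Gx; apply/centgmxP=> h Hh; have Gh := subsetP sHG h Hh.
  by rewrite -[rH h]/(rG h) -!repr_mxM // (centsP cGH h).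
have cHH: abelian H by rewrite /abelian (subset_trans cGH) ?centS.
apply/centsP=> x Gx y Gy; apply: (mx_faithful_inj ffulG); rewrite ?groupM //.
have:= centH x Gx; rewrite -memmx_cent_envelop => /cent_mxP cEx.
by rewrite !repr_mxM // cEx // abelian_irr_centgmx_envelop ?centH.
Qed.

End CentralIrreducible.

Section IrreducibleConjugation.

Variable gT : finGroupType.
Implicit Types A C K P : {group gT}.

Lemma minnormal_central_abelian (q : nat) K P C :
    q.-abelem K -> minnormal K P -> C \subset 'N(K) -> 'C_C(K) = 1 ->
    P \subset 'Z(C) ->
  abelian C.
Proof.
move=> abelK minK nKC regCK sPZ; have sPC := subset_trans sPZ (center_sub C).
have [/andP[ntK _] _] := mingroupP minK.
have irrP := elimT (abelem_mx_irrP abelK ntK (subset_trans sPC nKC)) minK.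
have ffulC := abelem_mx_faithful abelK ntK nKC regCK.
have irr_sub := proj2 (mxsimple_abelem_subg abelK ntK nKC sPC _) irrP.
exact: mx_faithful_central_irr_abelian ffulC irr_sub sPZ.
Qed.

Lemma semiregular_abelian_cyclic K A :
    solvable K -> K :!=: 1 -> A \subset 'N(K) -> semiregular K A -> abelian A ->
  cyclic A.
Proof.
move=> solK ntK nKA regKA cAA.
have [E minE sEK] := minnormal_exists ntK nKA.
have [nEA ntE /is_abelemP[q _ abelE]] := minnormal_solvable minE sEK solK.
have irrE := elimT (abelem_mx_irrP abelE ntE nEA) minE.
apply: mx_faithful_irr_abelian_cyclic irrE cAA.
apply: abelem_mx_faithful; apply: cent_semiregular sEK ntE.
exact: semiregular_sym.
Qed.

End IrreducibleConjugation.

Section Dedekind.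

Variable gT : finGroupType.
Implicit Types A C G H N Q : {group gT}.

Definition Dedekind (B : {set gT}) : Prop := forall A, A \subset B -> A <| B.

Definition cyclic_or_Q8_dprod (B : {set gT}) : Prop :=
  cyclic B \/
  exists Q C, [/\ Q \x C = B, Q \isog 'Q_8, cyclic C & odd #|C|].

Lemma DedekindS G H : H \subset G -> Dedekind G -> Dedekind H.
Proof.
move=> sHG dedG A sAH.
exact: normalS sAH sHG (dedG A (subset_trans sAH sHG)).
Qed.

Lemma abelian_Dedekind G : abelian G -> Dedekind G.
Proof. by move=> cGG A sAG; rewrite -sub_abelian_normal. Qed.

Lemma Dedekind_nilpotent G : Dedekind G -> nilpotent G.
Proof.
move=> dedG; have <-: 'F(G) = G; last exact: Fitting_nil.
apply/eqP; rewrite eqEsubset Fitting_sub; apply/subsetP=> x Gx.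
rewrite -cycle_subG Fitting_max ?dedG ?cycle_subG //.
by rewrite abelian_nil ?cycle_abelian.
Qed.

Lemma coprime_dprod_Dedekind G H N :
    H \x N = G -> coprime #|H| #|N| -> Dedekind H -> Dedekind N -> Dedekind G.
Proof.
move=> defG coHN dedH dedN A sAG; set pi := \pi(H).
have [nsHG nsNG] := dprod_normal2 defG.
have pi'N: pi^'.-group N by rewrite /pgroup -coprime_pi' ?cardG_gt0.
have [hallH hallN] := coprime_mulpG_Hall (dprodW defG) (pgroup_pi H) pi'N.
have nilA: nilpotent A.
  by rewrite (nilpotentS sAG) // (dprod_nil defG) !Dedekind_nilpotent.
rewrite -(dprodW (nilpotent_pcoreC pi nilA)) normalM //.
  apply: dprod_normal_subl defG _; apply: dedH.
  by rewrite (sub_normal_Hall hallH) ?pcore_pgroup ?gFsub_trans.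
rewrite dprodC in defG; apply: dprod_normal_subl defG _; apply: dedN.
by rewrite (sub_normal_Hall hallN) ?pcore_pgroup ?gFsub_trans.
Qed.

Lemma Q8_Dedekind Q : Q \isog 'Q_8 -> Dedekind Q.
Proof.
move=> isoQ A sAQ; have n_gt2: 2 < 3 by [].
have [[x y] genQ _] := generators_quaternion n_gt2 isoQ.
have [_ [der1Q _ _ _] [_ _ order2 _ _] _ _] :=
  quaternion_structure n_gt2 genQ isoQ.
have [->|ntA] := eqsVneq A 1; first exact: normal1.
have pQ: 2.-group Q by rewrite /pgroup (card_isog isoQ) (@card_quaternion 3).
have [_ /Cauchy[//|t At ot] _] := pgroup_pdiv (pgroupS sAQ pQ) ntA.
have x2: t = x ^+ 2 := order2 t (subsetP sAQ t At) ot.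
by apply: sub_der1_normal sAQ; rewrite der1Q cycle_subG -x2.
Qed.

Lemma cyclic_or_Q8_dprod_Dedekind G : cyclic_or_Q8_dprod G -> Dedekind G.
Proof.
case=> [/cyclic_abelian/abelian_Dedekind// | [Q [C [defG isoQ cycC oddC]]]].
apply: coprime_dprod_Dedekind defG _ (Q8_Dedekind isoQ) _.
  by rewrite (card_isog isoQ) (@card_quaternion 3) // coprimeXl ?coprime2n.
exact/abelian_Dedekind/cyclic_abelian.
Qed.

Lemma Dedekind_quaternion_eq3 Q n :
  n > 2 -> Q \isog 'Q_(2 ^ n) -> Dedekind Q -> n = 3.
Proof.
move=> n_gt2 isoQ dedQ.
have [[x y] genQ _] := generators_quaternion n_gt2 isoQ.
have [_ Qx ox Q'y] := genQ; have [Qy _] := setDP Q'y.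
have [[_ _ xV] _ _ _ _] := quaternion_structure n_gt2 genQ isoQ.
have yx: x ^ y = x^-1 by rewrite xV ?cycle_id.
have /cycleP[i x2]: x ^+ 2 \in <[y]>.
  have nYx: x \in 'N(<[y]>).
    by rewrite (subsetP (normal_norm (dedQ _ _))) ?cycle_subG.
  have <-: [~ y, x] = x ^+ 2 by rewrite commgEr conjVg yx invgK.
  by rewrite commgEl groupMl ?groupV ?memJ_norm ?cycle_id.
have x2V: x ^+ 2 = (x ^+ 2)^-1.
  by rewrite -expgVn -yx -conjXg x2 conjgE -expgSr expgS mulKg.
have /dvdn_leq: #[x] %| 2 ^ 2.
  by rewrite order_dvdn (expgM x 2 2) expgS {2}x2V mulgV.
rewrite ox leq_exp2l // => /(_ isT) n_le3.
by apply/eqP; rewrite eqn_leq n_gt2 andbT -ltnS -(ltn_predK n_gt2).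
Qed.

Lemma Dedekind_pgroup_cyclic_or_Q8 (p : nat) G :
    p.-group G -> Dedekind G ->
    (forall A, A \subset G -> abelian A -> cyclic A) ->
  cyclic G \/ p = 2 /\ G \isog 'Q_8.
Proof.
move=> pG dedG cycG.
have [G1|ntG] := eqsVneq G 1; first by left; rewrite G1 cyclic1.
have sG1Z: 'Ohm_1(G) \subset 'Z(G).
  rewrite (Ohm1Eprime G) gen_subG; apply/subsetP=> x /setIdP[Gx x_pr].
  have nsX: <[x]> <| G by rewrite dedG ?cycle_subG.
  have ntX: <[x]> != 1 by rewrite -cardG_gt1 prime_gt1.
  have := meet_center_nil (pgroup_nil pG) nsX ntX.
  by move/(prime_meetG x_pr); rewrite cycle_subG.
have cG1: abelian 'Ohm_1(G) := abelianS sG1Z (center_abelian G).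
have oG1: #|'Ohm_1(G)| = p.
  apply: cyclic_abelem_prime; rewrite ?abelem_Ohm1 ?Ohm1_eq1 //.
  by rewrite cycG ?Ohm_sub.
case/orP: (introT (prime_Ohm1P pG ntG) oG1) => [|/andP[/eqP p2]]; first by left.
move/eqP/quaternion_classP=> [n n_gt2 isoG]; right; split=> //.
by have:= isoG; rewrite (Dedekind_quaternion_eq3 n_gt2 isoG dedG).
Qed.

Lemma Dedekind_cyclic_or_Q8_dprod G :
    Dedekind G -> (forall A, A \subset G -> abelian A -> cyclic A) ->
  cyclic_or_Q8_dprod G.
Proof.
move=> dedG cycG; have nilG := Dedekind_nilpotent dedG.
have p_cyclic_or_Q8 (p : nat) H :
    p.-group H -> H \subset G -> cyclic H \/ p = 2 /\ H \isog 'Q_8.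
  move=> pH sHG; apply: Dedekind_pgroup_cyclic_or_Q8 pH (DedekindS sHG dedG) _.
  by move=> A sAH; apply/cycG/(subset_trans sAH).
have cyclic_oddpart: cyclic 'O_2^'(G).
  apply: nil_Zgroup_cyclic (nilpotentS (pcore_sub _ _) nilG).
  apply/forall_inP=> V /SylowP[p _ /and3P[sVO pV _]].
  have sVG := subset_trans sVO (pcore_sub _ _).
  have [//|[_ isoV]] := p_cyclic_or_Q8 p V pV sVG.
  have := pgroupS sVO (pcore_pgroup _ _).
  by rewrite /pgroup -odd_2'nat (card_isog isoV) (@card_quaternion 3).
have defG := nilpotent_pcoreC 2 nilG.
have [cycO2|[_ isoO2]] := p_cyclic_or_Q8 2 _ (pcore_pgroup 2 G) (pcore_sub 2 G).
  left; rewrite (cyclic_dprod defG) //.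
  by rewrite coprime_pcoreC.
right; exists 'O_2(G)%G, 'O_2^'(G)%G; split=> //.
by rewrite odd_2'nat; apply: pcore_pgroup.
Qed.

End Dedekind.

Section TI_subgroups.

Variable gT : finGroupType.
Implicit Types A G H M X : {group gT}.

Lemma TI_subgroupP X G :
  TI_subgroup X G <->
    {in G, forall g, X :^ g :&: X != 1 -> g \in 'N(X)}.
Proof.
split=> [tiX g Gg ntXg | tiX g Gg].
  have [Xg1|/setIidPr sXXg] := tiX g Gg; first by rewrite Xg1 eqxx in ntXg.
  by rewrite -groupV inE sub_conjgV.
have [->|/(tiX g Gg)/normP->] := eqVneq (X :^ g :&: X) 1; first by left.
by right; rewrite setIid.
Qed.

Lemma TI_subgroup_norm X G A :
  TI_subgroup X G -> A :!=: 1 -> A \subset X -> 'N_G(A) \subset 'N(X).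
Proof.
move/TI_subgroupP=> tiX ntA sAX; apply/subsetP=> g /setIP[Gg nAg].
apply: tiX => //; apply: contraNneq ntA => Xg1.
by rewrite -subG1 -Xg1 subsetI sAX andbT -(normP nAg) conjSg.
Qed.

Lemma TI_subgroupS M G X :
  TI_subgroup M G -> X \subset M -> 'N_G(M) \subset 'N(X) -> TI_subgroup X G.
Proof.
move/TI_subgroupP=> tiM sXM /subsetP nXN; apply/TI_subgroupP=> g Gg ntXg.
apply: nXN; rewrite inE Gg tiM //; apply: contraNneq ntXg => Mg1.
by rewrite -subG1 -Mg1 setISS ?conjSg.
Qed.

Lemma TI_subgroupJ X G g : TI_subgroup (X :^ g) (G :^ g) -> TI_subgroup X G.
Proof.
move=> tiX h Gh; have := tiX (h ^ g); rewrite memJ_conjg => /(_ Gh).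
rewrite -conjsgM -conjgC conjsgM -conjIg -{1}(conjs1g g).
by case=> /conjsg_inj; [left | right].
Qed.

Lemma Frobenius_complP G M :
  reflect [/\ M :!=: 1, M :!=: G, TI_subgroup M G & 'N_G(M) = M]
          [Frobenius G with complement M].
Proof.
apply: (iffP andP) => [[neqMG /normedTI_P[ntM sMN tiM]] | [ntM neqMG tiM defN]].
  rewrite setD_eq0 subG1 in ntM; rewrite normD1 in sMN.
  have memM: {in G, forall g, M :^ g :&: M != 1 -> g \in M}.
    move=> g Gg /trivgPn[x /setIP[Mgx Mx] ntx]; apply: tiM => //.
    by apply/pred0Pn; exists x; rewrite /= conjD1g !inE ntx Mx Mgx.
  split=> //.
    apply/TI_subgroupP=> g Gg /(memM g Gg) Mg.
    by have [_] := subsetIP sMN; move/subsetP; apply.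
  apply/eqP; rewrite eqEsubset sMN andbT; apply/subsetP=> g /setIP[Gg nMg].
  by apply: memM => //; rewrite (normP nMg) setIid.
split=> //; apply/normedTI_P; split; rewrite ?setD_eq0 ?subG1 ?normD1 ?defN //.
move=> g Gg /pred0Pn[x /andP[/setD1P[ntx Mx]]].
rewrite /= conjD1g => /setD1P[_ Mgx]; rewrite -defN inE Gg.
have /TI_subgroupP-> // := tiM; apply/trivgPn; exists x => //; exact/setIP.
Qed.

End TI_subgroups.

Arguments Frobenius_complP {gT G M}.

Section FrobeniusGroups.

Variable gT : finGroupType.
Implicit Types A G K L M X : {group gT}.

Lemma Frobenius_sdprod_context G K M :
    [Frobenius G = K ><| M] ->
  [/\ K <| G, M \subset G, K * M = G, M \subset 'N(K) & K :&: M = 1].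
Proof. by case/Frobenius_context=> /sdprod_context. Qed.

Lemma Frobenius_compl_not_sub_ker G K M A :
  [Frobenius G = K ><| M] -> A \subset M -> A :!=: 1 -> ~~ (A \subset K).
Proof.
move=> frobG sAM; have [_ _ _ _ tiKM] := Frobenius_sdprod_context frobG.
by apply: contra => sAK; rewrite -subG1 -tiKM subsetI sAK.
Qed.

Lemma Frobenius_nonnil G K M : [Frobenius G = K ><| M] -> ~~ nilpotent G.
Proof.
move=> frobG; have [_ ntK _ _ _] := Frobenius_context frobG.
have [/andP[sKG _] sMG _ _ _] := Frobenius_sdprod_context frobG.
apply: contra ntK => nilG; rewrite -(Frobenius_trivg_cent frobG).
by rewrite eqEsubset subsetIl subsetI subxx (sub_nilpotent_cent2 nilG) //
  coprime_sym (Frobenius_coprime frobG).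
Qed.

Lemma Frobenius_subsdprod G K M L A :
    [Frobenius G = K ><| M] -> L \subset K -> L :!=: 1 -> A \subset M ->
    A :!=: 1 -> A \subset 'N(L) ->
  [Frobenius L <*> A = L ><| A].
Proof.
move=> frobG sLK ntL sAM ntA nLA.
exact: Frobenius_subl ntL sLK nLA (Frobenius_subr ntA sAM frobG).
Qed.

Lemma Frobenius_ker_cent1 G K x :
  [Frobenius G with kernel K] -> x \in G :\: K -> 'C_K[x] = 1.
Proof.
case/Frobenius_kerP=> _ _ _ regK /setDP[Gx K'x].
apply/trivgP/subsetP=> y /setIP[Ky cxy]; apply: contraR K'x => nty.
rewrite (subsetP (regK y _)) //; first by rewrite in_setD nty.
by rewrite inE Gx cent1C.
Qed.

Lemma Frobenius_ker_sub_norm G K X :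
    [Frobenius G with kernel K] -> X \subset G -> ~~ (X \subset K) ->
    K \subset 'N(X) ->
  K \subset X.
Proof.
move=> frobG sXG /subsetPn[x Xx K'x]; have Gx := subsetP sXG x Xx.
have [_ _ /andP[_ nKG] _] := Frobenius_kerP frobG.
apply: fixfree_norm_sub Xx (subsetP nKG x Gx) _.
by rewrite (Frobenius_ker_cent1 frobG) // inE K'x.
Qed.

Lemma Frobenius_ker_sub_subnormal G K X :
    [Frobenius G with kernel K] -> ~~ (X \subset K) -> X <|<| G ->
  K \subset X.
Proof.
move=> frobG /subsetPn[x Xx K'x] snX.
have Gx := subsetP (subnormal_sub snX) x Xx.
have [_ _ /andP[sKG nKG] _] := Frobenius_kerP frobG.
apply: fixfree_subnormal_sub Xx (subsetP nKG x Gx) _ sKG snX.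
by rewrite (Frobenius_ker_cent1 frobG) // inE K'x.
Qed.

Lemma Frobenius_minnormal_ker G K M A :
    [Frobenius G = K ><| M] -> A \subset M -> A :!=: 1 ->
    (forall L, L \subset K -> [Frobenius L <*> A = L ><| A] ->
       K \subset 'N(L <*> A) \/ L <*> A <|<| G) ->
  minnormal K A.
Proof.
move=> frobG sAM ntA normLA; have [defG ntK _ _ _] := Frobenius_context frobG.
have [/andP[sKG _] sMG _ nKM _] := sdprod_context defG.
have frobK := FrobeniusWker frobG.
apply/mingroupP; rewrite ntK (subset_trans sAM) //; split=> // L.
move=> /andP[ntL nLA] sLK; have sAG := subset_trans sAM sMG.
have frobLA := Frobenius_subsdprod frobG sLK ntL sAM ntA nLA.
have not_sLAK: ~~ (L <*> A \subset K).
  apply: contra (Frobenius_compl_not_sub_ker frobG sAM ntA).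
  exact: subset_trans (joing_subr L A).
have sKLA: K \subset L <*> A.
  case: (normLA L sLK frobLA); last exact: Frobenius_ker_sub_subnormal frobK _.
  apply: Frobenius_ker_sub_norm frobK _ not_sLAK.
  by rewrite join_subG (subset_trans sLK).
by rewrite -(sdprod_ker_join defG sLK sAM nLA) (setIidPl sKLA).
Qed.

Lemma Frobenius_compl_abelian_cyclic G K M A :
    [Frobenius G = K ><| M] -> solvable K -> A \subset M -> abelian A ->
  cyclic A.
Proof.
move=> frobG solK sAM; have [_ ntK _ _ _] := Frobenius_context frobG.
have [_ _ _ nKM _] := Frobenius_sdprod_context frobG.
apply: (semiregular_abelian_cyclic solK ntK (subset_trans sAM nKM)).
exact: semiregularS (subxx K) sAM (Frobenius_reg_ker frobG).
Qed.

Lemma Frobenius_compl_cent_ker G K M A :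
  [Frobenius G = K ><| M] -> A \subset M -> 'C_A(K) = 1.
Proof.
move=> frobG sAM; have [_ ntK _ _ _] := Frobenius_context frobG.
apply: cent_semiregular (subxx K) ntK.
exact: semiregularS sAM (subxx K) (Frobenius_reg_compl frobG).
Qed.

Lemma Frobenius_cyclic_ker_compl_abelian G K M :
  [Frobenius G = K ><| M] -> cyclic K -> abelian M.
Proof.
move=> frobG cycK; have [_ _ _ nKM _] := Frobenius_sdprod_context frobG.
exact: cyclic_norm_abelian cycK nKM (Frobenius_compl_cent_ker frobG (subxx M)).
Qed.

Lemma Frobenius_abelem_ker_card (q : nat) G K M :
    [Frobenius G = K ><| M] -> q.-abelem K -> ~~ nilpotent M ->
  exists2 r, 1 < r & #|K| = (q ^ r)%N.
Proof.
move=> frobG abelK nonnilM; have [_ ntK _ _ _] := Frobenius_context frobG.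
have [q_pr _ [r oK]] := pgroup_pdiv (abelem_pgroup abelK) ntK.
exists r.+1; rewrite // ltnS lt0n; apply: contra nonnilM => /eqP r0.
apply/abelian_nil/(Frobenius_cyclic_ker_compl_abelian frobG).
by rewrite prime_cyclic // oK r0 expn1.
Qed.

Lemma Frobenius_abelem_ker_neq (p q : nat) G K M :
    [Frobenius G = K ><| M] -> prime p -> p %| #|M| -> q.-abelem K -> q != p.
Proof.
move=> frobG p_pr p_dvd_M abelK; have [_ ntK _ _ _] := Frobenius_context frobG.
have [q_pr q_dvd_K _] := pgroup_pdiv (abelem_pgroup abelK) ntK.
have := coprime_dvdl q_dvd_K (coprime_dvdr p_dvd_M (Frobenius_coprime frobG)).
by rewrite prime_coprime // dvdn_prime2.
Qed.

Lemma Frobenius_irr_cent_abelian (q : nat) G K M A :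
    [Frobenius G = K ><| M] -> q.-abelem K -> A \subset M -> abelian A ->
    minnormal K A ->
  abelian 'C_M(A).
Proof.
move=> frobG abelK sAM cAA minK; have sCM := subsetIl M 'C(A).
have [_ _ _ nKM _] := Frobenius_sdprod_context frobG.
apply: minnormal_central_abelian abelK minK (subset_trans sCM nKM) _ _.
  exact: Frobenius_compl_cent_ker frobG sCM.
by rewrite !subsetI sAM -abelianE cAA centsC subsetIr.
Qed.

(* A Sylow subgroup of K is normalised by some complement, so it is all of K. *)
Lemma Frobenius_irr_ker_abelem G K :
    [Frobenius G with kernel K] ->
    (forall A : {group gT}, K ><| A = G -> minnormal K A) ->
  is_abelem K.
Proof.
move=> frobG minK; have [ntK _ nsKG _] := Frobenius_kerP frobG.
have [/eqP|[q q_pr q_dvd_K]] := trivgVpdiv K; first by rewrite (negPf ntK).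
have [S sylS] := Sylow_exists q K; have [sSK qS _] := and3P sylS.
have hallK: Hall G K by rewrite /Hall normal_sub ?(Frobenius_ker_coprime frobG).
have [A defG nSA] := normal_Hall_sdprod_norm_Sylow nsKG hallK sylS.
have ntS: S :!=: 1.
  by rewrite -cardG_gt1 (card_Hall sylS) p_part_gt1 mem_primes q_pr cardG_gt0.
have defK: S :=: K by have [_ ->] := mingroupP (minK A defG); rewrite ?ntS.
have solK: solvable K by rewrite -defK (pgroup_sol qS).
by have [] := minnormal_solvable (minK A defG) (subxx K) solK.
Qed.

End FrobeniusGroups.

Section TIorSubnormal.

Variables (gT : finGroupType) (p : nat).
Implicit Types A B G H K L M P X Y : {group gT}.

Definition nonnil_dvdn (B : {set gT}) : {set {group gT}} :=
  [set X : {group gT} | [&& X \subset B, ~~ nilpotent X & p %| #|X|]].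

Definition TI_or_subnormal (B : {set gT}) : Prop :=
  {in nonnil_dvdn B, forall X, TI_subgroup X B \/ X <|<| B}.

Lemma TI_or_subnormalP G :
  (forall X, X \subset G -> ~~ nilpotent X ->
     [\/ TI_subgroup X G, X <|<| G | ~~ (p %| #|X|)])
  <-> TI_or_subnormal G.
Proof.
split=> [tiG X | tiG X sXG nonnilX].
  rewrite inE => /and3P[sXG nonnilX p_dvd_X].
  by case: (tiG X sXG nonnilX); [left | right | rewrite p_dvd_X].
have [p_dvd_X|] := boolP (p %| #|X|); last by constructor 3.
have [|tiX|snX] := tiG X; first by rewrite inE sXG nonnilX.
  by constructor 1.
by constructor 2.
Qed.

Lemma nonnil_dvdnS G X Y :
  X \in nonnil_dvdn G -> X \subset Y -> Y \subset G -> Y \in nonnil_dvdn G.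
Proof.
rewrite !inE => /and3P[_ nnX p_dvd_X] sXY ->; rewrite (contra _ nnX) /=.
  exact: dvdn_trans p_dvd_X (cardSg sXY).
exact: nilpotentS.
Qed.

Lemma max_nonsubnormal_Frobenius_compl G X :
    TI_or_subnormal G -> X \in nonnil_dvdn G -> ~~ (X <|<| G) ->
  exists M, [/\ [Frobenius G with complement M], M \in nonnil_dvdn G
    & {in nonnil_dvdn G, forall Y, #|M| < #|Y| -> Y <|<| G}].
Proof.
move=> tiG nnX nsnX.
pose nonsubnormal Y := (Y \in nonnil_dvdn G) && ~~ (Y <|<| G).
have nonsubX: nonsubnormal X by apply/andP.
case: (arg_maxnP (fun Y : {group gT} => #|Y|) nonsubX) => M.
case/andP=> nnM nsnM maxM; have /[1!inE]/and3P[sMG nonnilM _] := nnM.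
exists M; split=> // [|Y nnY]; last first.
  by rewrite ltnNge; apply: contraR => nsnY; apply: maxM; apply/andP.
have sMN: M \subset 'N_G(M) by rewrite subsetI sMG normG.
apply/Frobenius_complP; split.
- by apply: contraNneq nonnilM => ->; apply: nilpotent1.
- by apply: contraNneq nsnM => ->; apply: subnormal_refl.
- by case: (tiG M nnM) => // snM; rewrite snM in nsnM.
apply/eqP; rewrite eq_sym eqEcard sMN; apply: maxM; apply/andP; split.
  by rewrite (nonnil_dvdnS nnM) ?subsetIl.
apply: contra nsnM; apply: subnormal_trans; apply: normal_subnormal.
exact: normalSG.
Qed.

Lemma max_nonsubnormal_ker_abelem G K M :
    [Frobenius G = K ><| M] -> M \in nonnil_dvdn G ->
    {in nonnil_dvdn G, forall Y, #|M| < #|Y| -> Y <|<| G} ->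
  is_abelem K.
Proof.
move=> frobG /[1!inE]/and3P[_ _ p_dvd_M] maxM.
have frobK := FrobeniusWker frobG.
have [defG _ ntM _ _] := Frobenius_context frobG.
apply: (Frobenius_irr_ker_abelem frobK) => A defKA.
have oA: #|A| = #|M|.
  apply/eqP; rewrite -(eqn_pmul2l (cardG_gt0 K)).
  by rewrite (sdprod_card defKA) (sdprod_card defG).
have ntA: A :!=: 1 by rewrite -cardG_gt1 oA cardG_gt1.
have frobA := set_Frobenius_compl defKA frobK.
apply: (Frobenius_minnormal_ker frobA (subxx A) ntA) => L sLK frobLA.
have [defLA ntL _ _ _] := Frobenius_context frobLA.
have [/andP[sKG _] sAG _ _ _] := Frobenius_sdprod_context frobA.
right; apply: maxM; rewrite -?oA -?(sdprod_card defLA).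
  rewrite inE join_subG (subset_trans sLK) // sAG (Frobenius_nonnil frobLA).
  by rewrite -(sdprod_card defLA) oA dvdn_mull.
by rewrite ltn_Pmull ?cardG_gt0 ?cardG_gt1.
Qed.

Lemma nonsubnormal_Frobenius G X :
    TI_or_subnormal G -> X \in nonnil_dvdn G -> ~~ (X <|<| G) ->
  exists K M,
    [/\ [Frobenius G = K ><| M], is_abelem K, ~~ nilpotent M & p %| #|M|].
Proof.
move=> tiG nnX nsnX.
have [M [frobM nnM maxM]] := max_nonsubnormal_Frobenius_compl tiG nnX nsnX.
have [K frobG] := Frobenius_kernel_exists frobM; exists K, M.
rewrite (max_nonsubnormal_ker_abelem frobG nnM maxM).
by have /[1!inE]/and3P[] := nnM.
Qed.

Section FrobeniusComplement.

Variables (q : nat) (G K M : {group gT}).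
Hypotheses (p_pr : prime p) (tiG : TI_or_subnormal G).
Hypotheses (frobG : [Frobenius G = K ><| M]) (abelK : q.-abelem K).
Hypothesis nonnilM : ~~ nilpotent M.

Lemma compl_join_TI_or_subnormal A L :
    A \subset M -> p %| #|A| -> L \subset K -> [Frobenius L <*> A = L ><| A] ->
  TI_subgroup (L <*> A) G \/ L <*> A <|<| G.
Proof.
move=> sAM p_dvd_A sLK frobLA; apply: tiG.
have [/andP[sKG _] sMG _ _ _] := Frobenius_sdprod_context frobG.
rewrite inE join_subG (subset_trans sLK) // (subset_trans sAM) //.
rewrite (Frobenius_nonnil frobLA) /=.
exact: dvdn_trans p_dvd_A (cardSg (joing_subr L A)).
Qed.

Lemma compl_minnormal_ker A : A \subset M -> p %| #|A| -> minnormal K A.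
Proof.
move=> sAM p_dvd_A; have ntA := dvdn_card_nontrivial p_pr p_dvd_A.
have [/andP[sKG _] _ _ _ _] := Frobenius_sdprod_context frobG.
apply: (Frobenius_minnormal_ker frobG sAM ntA) => L sLK frobLA.
have [tiLA|] := compl_join_TI_or_subnormal sAM p_dvd_A sLK frobLA;
  last by right.
have [_ ntL _ _ _] := Frobenius_context frobLA.
left; apply: subset_trans (TI_subgroup_norm tiLA ntL (joing_subl L A)).
by rewrite subsetI sKG sub_abelian_norm ?(abelem_abelian abelK).
Qed.

Lemma compl_abelian_cyclic A : A \subset M -> abelian A -> cyclic A.
Proof.
apply: Frobenius_compl_abelian_cyclic frobG _.
exact/abelian_sol/(abelem_abelian abelK).
Qed.

Lemma compl_cent_abelian A :
  A \subset M -> p %| #|A| -> abelian A -> abelian 'C_M(A).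
Proof.
move=> sAM p_dvd_A cAA; have minK := compl_minnormal_ker sAM p_dvd_A.
exact: Frobenius_irr_cent_abelian frobG abelK sAM cAA minK.
Qed.

Lemma compl_abelian_noncentral A :
  A \subset M -> p %| #|A| -> abelian A -> ~~ (M \subset 'C(A)).
Proof.
move=> sAM p_dvd_A cAA; apply: contra nonnilM => /setIidPl <-.
exact/abelian_nil/compl_cent_abelian.
Qed.

Lemma compl_subnormal A : A \subset M -> p %| #|A| -> A <|<| M.
Proof.
move=> sAM p_dvd_A; have ntA := dvdn_card_nontrivial p_pr p_dvd_A.
have [defG ntK _ _ _] := Frobenius_context frobG.
have [/andP[sKG nKG] sMG _ _ _] := sdprod_context defG.
have sAG := subset_trans sAM sMG; have frobKA := Frobenius_subr ntA sAM frobG.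
rewrite -(sdprod_compl_join defG sAM) setIC; apply: setI_subnormal sMG _.
have [tiKA|//] := compl_join_TI_or_subnormal sAM p_dvd_A (subxx K) frobKA.
apply: normal_subnormal; rewrite /normal join_subG sKG sAG.
apply: subset_trans (TI_subgroup_norm tiKA ntK (joing_subl K A)).
by rewrite subsetI subxx.
Qed.

Lemma compl_overgroup_normal A X :
    A <| M -> A :!=: 1 -> A \subset X -> X \subset M -> ~~ nilpotent X ->
    p %| #|X| ->
  X <| M.
Proof.
move=> nsAM ntA sAX sXM nonnilX p_dvd_X.
have [_ ntK _ _ _] := Frobenius_context frobG.
have [_ sMG _ _ tiKM] := Frobenius_sdprod_context frobG.
rewrite /normal sXM /=.
have nnX: X \in nonnil_dvdn G by rewrite inE (subset_trans sXM) ?nonnilX.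
have [tiX|snX] := tiG nnX.
  apply: subset_trans (TI_subgroup_norm tiX ntA sAX).
  by rewrite subsetI sMG normal_norm.
have ntX := dvdn_card_nontrivial p_pr p_dvd_X.
have not_sXK := Frobenius_compl_not_sub_ker frobG sXM ntX.
have sKX := Frobenius_ker_sub_subnormal (FrobeniusWker frobG) not_sXK snX.
by case/negP: ntK; rewrite -subG1 -tiKM subsetI subxx (subset_trans sKX).
Qed.

Lemma compl_Sylow_normal P : p %| #|M| -> p.-Sylow(M) P -> P <| M.
Proof.
move=> p_dvd_M sylP; apply: (subnormal_Hall_normal sylP).
exact: compl_subnormal (pHall_sub sylP) (dvdn_card_Sylow p_pr sylP p_dvd_M).
Qed.

Section SylowComplement.

Variables P H : {group gT}.
Hypotheses (sylP : p.-Sylow(M) P) (defM : P ><| H = M) (p_dvd_M : p %| #|M|).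

Lemma compl_Sylow_cyclic : cyclic P.
Proof.
have p_dvd_P := dvdn_card_Sylow p_pr sylP p_dvd_M.
have [sPM pP _] := and3P sylP.
have ntZ: 'Z(P) != 1.
  by rewrite center_nil_eq1 ?(pgroup_nil pP) ?(dvdn_card_nontrivial p_pr).
have [_ /Cauchy[//|x Zx ox] _] := pgroup_pdiv (pgroupS (center_sub P) pP) ntZ.
have [Px cPx] := setIP Zx.
have sxM: <[x]> \subset M by rewrite cycle_subG (subsetP sPM).
have cCx: abelian 'C_M(<[x]>).
  by rewrite compl_cent_abelian ?cycle_abelian // -orderE ox.
apply: (compl_abelian_cyclic sPM); apply: abelianS cCx.
by rewrite subsetI sPM centsC cycle_subG.
Qed.

Lemma compl_Sylow_join_normal A B :
    A <| M -> A \subset P -> p %| #|A| -> B \subset H -> ~~ (B \subset 'C(A)) ->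
  A <*> B <| M.
Proof.
move=> nsAM sAP p_dvd_A sBH ncAB; have [_ sHM _ _ _] := sdprod_context defM.
have ntA := dvdn_card_nontrivial p_pr p_dvd_A.
apply: (compl_overgroup_normal nsAM ntA).
- exact: joing_subl.
- by rewrite join_subG normal_sub ?(subset_trans sBH).
- apply: coprime_join_nonnil ncAB; apply: coprimeSg sAP (coprimegS sBH _).
  by rewrite (coprime_sdprod_Hall_l defM) (pHall_Hall sylP).
exact: dvdn_trans p_dvd_A (cardSg (joing_subl A B)).
Qed.

Lemma card_compl_Sylow : #|P| = p.
Proof.
have cycP := compl_Sylow_cyclic; have cPP := cyclic_abelian cycP.
have [nsPM sHM defPH nPH _] := sdprod_context defM.
have sPM := normal_sub nsPM.
have [x Px ox] := Cauchy p_pr (dvdn_card_Sylow p_pr sylP p_dvd_M).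
pose P0 := <[x]>%G; have oP0: #|P0| = p by [].
have p_dvd_P0: p %| #|P0| by rewrite oP0.
have sP0P: P0 \subset P by rewrite cycle_subG.
have nsP0M: P0 <| M by apply: char_normal_trans nsPM; rewrite sub_cyclic_char.
have ncP0H: ~~ (H \subset 'C(P0)).
  have sP0M := subset_trans sP0P sPM.
  have ncP0M := compl_abelian_noncentral sP0M p_dvd_P0 (cycle_abelian x).
  apply: contra ncP0M => cP0H.
  by rewrite -defPH mul_subG // (subset_trans cPP) ?centS.
have [h Hh ncP0h] := subsetPn ncP0H.
have nsXM := compl_Sylow_join_normal nsP0M sP0P p_dvd_P0 (subxx H) ncP0H.
have sPX: P \subset P0 <*> H.
  apply: (@fixfree_norm_sub _ P (P0 <*> H)%G h).
  - by rewrite (subsetP (joing_subr _ _)).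
  - exact: (subsetP nPH).
  - exact: cyclic_pgroup_cent1_eq1 (pHall_pgroup sylP) cycP sP0P oP0 ncP0h.
  exact: subset_trans sPM (normal_norm nsXM).
have nP0H := subset_trans sHM (normal_norm nsP0M).
by rewrite -oP0 -(sdprod_ker_join defM sP0P (subxx H) nP0H) (setIidPl sPX).
Qed.

Lemma compl_Sylow_noncentral : ~~ (H \subset 'C(P)).
Proof.
have cPP := cyclic_abelian compl_Sylow_cyclic.
have [/andP[sPM _] _ defPH _ _] := sdprod_context defM.
have p_dvd_P := dvdn_card_Sylow p_pr sylP p_dvd_M.
apply: contra (compl_abelian_noncentral sPM p_dvd_P cPP) => cPH.
by rewrite -defPH mul_subG.
Qed.

Lemma compl_prime_gt2 : 2 < p.
Proof.
rewrite ltn_neqAle prime_gt1 // andbT; apply: contraNneq compl_Sylow_noncentral.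
have [_ _ _ nPH _] := sdprod_context defM.
by move=> p2; rewrite card2_norm_cent ?card_compl_Sylow.
Qed.

Lemma compl_Sylow_compl_Dedekind : Dedekind H.
Proof.
move=> A sAH; have cPP := cyclic_abelian compl_Sylow_cyclic.
have [nsPM sHM _ _ _] := sdprod_context defM.
have sPM := normal_sub nsPM.
have p_dvd_P := dvdn_card_Sylow p_pr sylP p_dvd_M.
have [cPA|ncPA] := boolP (A \subset 'C(P)).
  have cCP := compl_cent_abelian sPM p_dvd_P cPP.
  have cycCP := compl_abelian_cyclic (subsetIl M _) cCP.
  have sACP: A \subset 'C_M(P) by rewrite subsetI (subset_trans sAH).
  have nsCP: 'C_M(P) <| M by rewrite norm_normalI ?norms_cent ?normal_norm.
  by apply: normalS sAH sHM (char_normal_trans _ nsCP); rewrite sub_cyclic_char.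
rewrite -(sdprod_compl_join defM sAH).
exact: normalGI sHM (compl_Sylow_join_normal nsPM (subxx P) p_dvd_P sAH ncPA).
Qed.

End SylowComplement.

Lemma Frobenius_compl_structure :
    p %| #|M| ->
  exists P H,
    [/\ 2 < p, P ><| H = M, p.-Sylow(G) P & #|P| = p] /\
    [/\ cyclic_or_Q8_dprod H, [~: P, H] != 1 & minnormal K P].
Proof.
move=> p_dvd_M; have [P sylP] := Sylow_exists p M.
have nsPM := compl_Sylow_normal p_dvd_M sylP; have [sPM nPM] := andP nsPM.
have [H defM] : exists H : {group gT}, P ><| H = M.
  have /splitsP[H /complP[tiPH defPH]] :=
    SchurZassenhaus_split (pHall_Hall sylP) nsPM.
  exists H; rewrite sdprodE ?(subset_trans _ nPM) //.
  by rewrite -defPH mulG_subr.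
have [_ sHM _ _ _] := sdprod_context defM.
exists P, H; split; split=> //.
- exact: compl_prime_gt2 sylP defM p_dvd_M.
- apply: subHall_Sylow (Hall_pi (Frobenius_compl_Hall frobG)) _ sylP.
  by rewrite mem_primes p_pr cardG_gt0.
- exact: card_compl_Sylow sylP defM p_dvd_M.
- apply: Dedekind_cyclic_or_Q8_dprod => [|A sAH].
    exact: compl_Sylow_compl_Dedekind sylP defM p_dvd_M.
  exact: compl_abelian_cyclic (subset_trans sAH sHM).
- apply: contra (compl_Sylow_noncentral sylP defM p_dvd_M) => /eqP/commG1P.
  by rewrite centsC.
exact: compl_minnormal_ker sPM (dvdn_card_Sylow p_pr sylP p_dvd_M).
Qed.

End FrobeniusComplement.

End TIorSubnormal.

Section FrobeniusTI.

Variable gT : finGroupType.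
Implicit Types A G H K M P X : {group gT}.

Lemma Frobenius_TI_ker_sub_compl G K M P X :
    [Frobenius G = K ><| M] -> P <| M -> P :!=: 1 -> P \subset X ->
    X \subset G -> X :&: K = 1 ->
  X \subset M.
Proof.
move=> frobG /andP[sPM nPM] ntP sPX sXG tiXK.
have [_ _ tiM defN] := Frobenius_complP (FrobeniusWcompl frobG).
have [/andP[sKG nKG] sMG defG nKM _] := Frobenius_sdprod_context frobG.
have nPX: X \subset 'N(P).
  have nsKPG: K <*> P <| G.
    rewrite /normal join_subG sKG (subset_trans sPM) //= -defG mul_subG //.
      by rewrite (subset_trans (joing_subl K P)) ?normG.
    by rewrite normsY.
  have <-: X :&: (K <*> P) = P.
    by rewrite norm_joinEr ?(subset_trans sPM) // -group_modr // tiXK mul1g.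
  exact: normal_norm (normalGI sXG nsKPG).
rewrite -defN subsetI sXG.
by apply: subset_trans (TI_subgroup_norm tiM ntP sPM); rewrite subsetI sXG.
Qed.

Lemma Frobenius_irr_TI_or_normal G K M P X :
    [Frobenius G = K ><| M] -> minnormal K P -> P <| M -> P :!=: 1 ->
    (forall A, P \subset A -> A \subset M -> A <| M) ->
    P \subset X -> X \subset G ->
  TI_subgroup X G \/ X <| G.
Proof.
move=> frobG minK nsPM ntP nsM sPX sXG.
have [defG _ _ _ _] := Frobenius_context frobG; have [sPM _] := andP nsPM.
have [tiXK|ntXK] := eqVneq (X :&: K) 1.
  have sXM := Frobenius_TI_ker_sub_compl frobG nsPM ntP sPX sXG tiXK.
  have [_ _ tiM defN] := Frobenius_complP (FrobeniusWcompl frobG).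
  by left; apply: (TI_subgroupS tiM sXM); rewrite defN normal_norm ?nsM.
have [/andP[_ nKP] irrK] := mingroupP minK.
have sKX: K \subset X.
  rewrite -(irrK (X :&: K)%G) ?subsetIl ?subsetIr // ntXK.
  by rewrite normsI // (subset_trans sPX) ?normG.
right; apply: sdprod_sub_normal defG sKX sXG _.
by apply: nsM; rewrite ?subsetIl // subsetI sPM.
Qed.

Lemma Dedekind_Frobenius_TI_or_normal (p : nat) G K M P H X :
    prime p -> [Frobenius G = K ><| M] -> P ><| H = M -> p.-Sylow(G) P ->
    #|P| = p -> Dedekind H -> minnormal K P -> X \subset G -> p %| #|X| ->
  TI_subgroup X G \/ X <| G.
Proof.
move=> p_pr frobG defM sylP oP dedH minK sXG p_dvd_X.
have [g Gg sPXg] := prime_Sylow_sub_conj p_pr sylP oP sXG p_dvd_X.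
have ntP: P :!=: 1 by rewrite -cardG_gt1 oP prime_gt1.
have [nsPM _ _ _ _] := sdprod_context defM.
have nsM A : P \subset A -> A \subset M -> A <| M.
  move=> sPA sAM.
  exact: sdprod_sub_normal defM sPA sAM (dedH _ (subsetIl H A)).
have sXgG: X :^ g \subset G by rewrite -(conjGid Gg) conjSg.
have [] := Frobenius_irr_TI_or_normal frobG minK nsPM ntP nsM sPXg sXgG.
  by rewrite -{1}(conjGid Gg) => /TI_subgroupJ; left.
by rewrite -{1}(conjGid Gg) normalJ; right.
Qed.

End FrobeniusTI.

Theorem theorem1p2 (gT : finGroupType) (G : {group gT}) (p : nat) :
  prime p -> (p %| #|G|)%N ->
  (forall X : {group gT}, X \subset G -> ~~ nilpotent X ->
     [\/ TI_subgroup X G, X <|<| G | ~~ (p %| #|X|)%N])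
  <->
  ((forall X : {group gT}, X \subset G -> ~~ nilpotent X ->
      (p %| #|X|)%N -> X <|<| G)
   \/
   (2 < p /\
    exists q r : nat, exists K P H M : {group gT},
      [/\ prime q, q != p, 1 < r, q.-abelem K & #|K| = (q ^ r)%N] /\
      [/\ K ><| M = G, P ><| H = M, [Frobenius G = K ><| M],
          P \in 'Syl_p(G) & #|P| = p] /\
      [/\ cyclic H \/
            (exists Q C : {group gT},
               [/\ Q \x C = H, Q \isog 'Q_8, cyclic C & odd #|C|]),
          [~: P, H] != 1
        & acts_irreducibly P K 'J])).
Proof.
move=> p_pr _; split=> [/TI_or_subnormalP tiG | ].
  have [/forall_inP snG | /forall_inPn[X nnX nsnX]] :=
    boolP [forall X in nonnil_dvdn p G, X <|<| G].
    by left=> X sXG nonnilX p_dvd_X; apply: snG; rewrite inE sXG nonnilX.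
  have [K [M [frobG /is_abelemP[q q_pr abelK] nonnilM p_dvd_M]]] :=
    nonsubnormal_Frobenius tiG nnX nsnX.
  have [r r_gt1 oK] := Frobenius_abelem_ker_card frobG abelK nonnilM.
  have [P [H [[p_gt2 defM sylP oP] [defH ntPH irrP]]]] :=
    Frobenius_compl_structure p_pr tiG frobG abelK nonnilM p_dvd_M.
  right; split=> //; exists q, r, K, P, H, M; split.
    by split=> //; apply: Frobenius_abelem_ker_neq frobG p_pr p_dvd_M abelK.
  have [defG _ _ _ _] := Frobenius_context frobG.
  by rewrite inE acts_irreducibly_J.
case=> [snG | [_ [q [r [K [P [H [M [_ [defG [defH _ irrP]]]]]]]]]]];
  apply/TI_or_subnormalP=> X; rewrite inE => /and3P[sXG nonnilX p_dvd_X].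
  by right; apply: snG.
have [_ defM frobG] := defG; rewrite inE => sylP oP.
rewrite acts_irreducibly_J in irrP.
have dedH := cyclic_or_Q8_dprod_Dedekind defH.
have [|/normal_subnormal] := Dedekind_Frobenius_TI_or_normal p_pr frobG defM
  sylP oP dedH irrP sXG p_dvd_X; by [left | right].
Qed.
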